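(* Let $P$ be a countable meet-continuous dcpo such that, for every $r\in P$, every nonempty subset of the principal ideal $\mathord{\downarrow}r$ has a supremum in $\mathord{\downarrow}r$. Suppose that for all $x,y\in P$ there is a finite set $F_{x,y}\subseteq P$, possibly empty, such that \[ \mathord{\uparrow}x\cap\mathord{\uparrow}y=\mathord{\uparrow}F_{x,y}. \] Then the Scott space $\Sigma P$ is sober.
   Context: All posets and directed sets are nonempty; countable sets may be finite. A subset $D$ of a poset is directed if any two of its elements have a common upper bound in $D$. A dcpo is a poset in which every directed subset has a supremum. Write $\mathord{\downarrow}x=\{y:y\le x\}$, $\mathord{\uparrow}x=\{y:x\le y\}$, $\mathord{\downarrow}A=\bigcup_{a\in A}\mathord{\downarrow}a$ and $\mathord{\uparrow}A=\bigcup_{a\in A}\mathord{\uparrow}a$. A supremum in $\mathord{\downarrow}r$ means a least upper bound computed in $\mathord{\downarrow}r$ with its induced order. For a dcpo $P$, an upper set $U\subseteq P$ is Scott open if for every directed $D\subseteq P$, $\bigvee D\in U$ implies $D\cap U\neq\emptyset$; the Scott open sets form the Scott topology $\sigma(P)$, and $\Sigma P=(P,\sigma(P))$ is the Scott space. A dcpo $P$ is meet-continuous if for every $x\in P$ and every directed $D\subseteq P$, $x\le\bigvee D$ implies $x\in\operatorname{cl}_{\sigma(P)}(\mathord{\downarrow}x\cap\mathord{\downarrow}D)$, where $\operatorname{cl}_{\sigma(P)}$ is closure in the Scott topology. A nonempty Scott-closed set $A$ is irreducible if any two open sets meeting $A$ have an intersection meeting $A$. $\Sigma P$ is sober if each irreducible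 closed set $A$ equals $\mathord{\downarrow}a$ for a unique $a\in P$. *)

(* Defs.v *)
From HB Require Import structures.
From mathcomp Require Import all_boot all_order.
From mathcomp Require Import boolp classical_sets cardinality topology.

Set Implicit Arguments.
Unset Strict Implicit.
Unset Printing Implicit Defensive.

Import Order.TTheory.
Local Open Scope order_scope.
Local Open Scope classical_set_scope.

(* For sets A, the lower closure is the library's [down A] and "s is the
   supremum of A" is the library's [isLub A s]. *)

Section Poset.
Context {d : Order.disp_t} {P : porderType d}.
Implicit Types (x y r s : P) (A B D U : set P).

Definition principal_down x : set P := [set y | y <= x].
Definition principal_up x : set P := [set y | x <= y].
Definition up A : set P := [set y | exists x, A x /\ x <= y].

Definition directed D : Prop :=
  D !=set0 /\ forall x y, D x -> D y -> exists z, [/\ D z, x <= z & y <= z].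

(* Supremum of A computed in the subset B with its induced order. *)
Definition isLub_in B A s : Prop :=
  [/\ B s, ubound A s & forall b, B b -> ubound A b -> s <= b].

Definition upper_set U : Prop := forall x y, U x -> x <= y -> U y.

(* On a poset that is not a dcpo, only the existing directed suprema count. *)
Definition scott_open U : Prop :=
  upper_set U /\
  forall D s, directed D -> isLub D s -> U s -> D `&` U !=set0.

End Poset.

Definition dcpo {d : Order.disp_t} (P : porderType d) : Prop :=
  forall D : set P, directed D -> exists s, isLub D s.

(* An alias, so that the Scott topology does not become a canonical topology
   on the poset P itself. *)
Definition scott_space {d : Order.disp_t} (P : porderType d) : Type := P.

Section ScottTopology.
Context {d : Order.disp_t} {P : porderType d}.

Let scott_openT : scott_open [set: P].
Proof. by split=> // D s [D0 _] _ _; rewrite setIT. Qed.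

Let scott_openI : setI_closed (@scott_open d P).
Proof.
move=> U V [Uup UD] [Vup VD]; split.
  by move=> x y [Ux Vx] xy; split; [exact: Uup xy|exact: Vup xy].
move=> D s Ddir Ds [Us Vs].
have [x [Dx Ux]] := UD _ _ Ddir Ds Us.
have [y [Dy Vy]] := VD _ _ Ddir Ds Vs.
have [z [Dz xz yz]] := Ddir.2 _ _ Dx Dy.
by exists z; split=> //; split; [exact: Uup xz|exact: Vup yz].
Qed.

Let scott_open_bigU (I : Type) (f : I -> set P) :
  (forall i, scott_open (f i)) -> scott_open (\bigcup_i f i).
Proof.
move=> fo; split.
  by move=> x y [i _ fx] xy; exists i => //; exact: (fo i).1 xy.
move=> D s Ddir Ds [i _ fs].
by have [x [Dx fx]] := (fo i).2 _ _ Ddir Ds fs; exists x; split=> //; exists i.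
Qed.

HB.instance Definition _ := Choice.on (scott_space P).
HB.instance Definition _ :=
  isOpenTopological.Build (scott_space P)
    scott_openT scott_openI scott_open_bigU.

Lemma scott_space_openE : @open (scott_space P) = @scott_open d P.
Proof. by []. Qed.

End ScottTopology.

Definition meet_continuous {d : Order.disp_t} (P : porderType d) : Prop :=
  forall (x : P) (D : set P) (s : P), directed D -> isLub D s -> x <= s ->
    closure (principal_down x `&` down D : set (scott_space P)) x.

Definition irreducible_closed {T : topologicalType} (A : set T) : Prop :=
  [/\ A !=set0, closed A &
    forall U V : set T, open U -> open V ->
      A `&` U !=set0 -> A `&` V !=set0 -> A `&` (U `&` V) !=set0].

Definition scott_sober {d : Order.disp_t} (P : porderType d) : Prop :=
  forall A : set (scott_space P), irreducible_closed A ->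
    exists! a : P, A = principal_down a.

(* Main.v *)
(* An irreducible Scott-closed set A turns out to be directed, hence equal to
   the lower set of its supremum. If a, b in A had no upper bound in A, then
   (a, b) would lie in O = {(x, y) : no upper bound of x, y is in A}. The finite
   sets F_{x,y} make the sections of O Scott open, so it suffices to find Scott
   open U, V with (a, b) in U x V and U x V included in O: then U and V meet A
   while their intersection does not.
   The box comes from a descending sequence (m_n) in O starting at (a, b), such
   that the upper set generated by its members is Scott open below (a, b). It is
   built by diagonalization over the countably many elements r and pairs (a', z):
   - put m_{n+1} below r whenever r lies above some member of O below m_n;
   - if some directed D with supremum above m_n contains a' but has z outside its
     lower closure, keep a' and m_{n+1} jointly below some c not above z.
   If D defeats the sequence, one chooses increasing a_i in D, indices n_i and
   y_i in O below a_i and m_{n_i}. The supremum r of the y_i below (a, b) lies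
   above some m_k by the first rule. But r is below every common upper bound of
   a_i and m_{n_{i+1}}, one of which is not above m_{n_i} by the second rule. *)

Require Import Defs.
From mathcomp Require Import all_boot all_order.
From mathcomp Require Import boolp classical_sets cardinality topology.

Import Order.TTheory.
Local Open Scope order_scope.
Local Open Scope classical_set_scope.

(** * Enumerations in which every value recurs *)

Lemma countable_recurrent_enum (T : Type) (x0 : T) :
  countable [set: T] ->
  exists tau : nat -> T, forall x N, exists2 n, (N <= n)%N & tau n = x.
Proof.
move=> /countable_injP[f f_inj].
have f_injT x y : f x = f y -> x = y by apply: f_inj; rewrite in_setT.
have /choice[g gP] : forall k, exists x, forall z, f z = k -> x = z.
  move=> k; have [[x fx]|nofx] := pselect (exists x, f x = k).
    by exists x => z fz; apply: f_injT; rewrite fx fz.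
  by exists x0 => z fz; case: nofx; exists z.
(* The 2-adic valuation of [n.+1] takes each value infinitely often; [2 ^ f x * (2 * N).+1] has
   valuation [f x] and exceeds [N]. *)
exists (fun n => g (logn 2 n.+1)) => x N.
have pos : (0 < 2 ^ f x * (2 * N).+1)%N by rewrite muln_gt0 expn_gt0.
exists (2 ^ f x * (2 * N).+1).-1.
  rewrite -ltnS prednK //; apply: (@leq_trans (2 * N).+1).
    by rewrite ltnS leq_pmull.
  by rewrite leq_pmull // expn_gt0.
rewrite prednK // lognM ?expn_gt0 // pfactorK //.
rewrite [logn 2 (2 * N).+1]lognE /= dvdn2 /= oddM /= addn0.
exact: gP.
Qed.

(** * Diagonal construction of the descending chain *)

Section DescendingChain.
Context {d : Order.disp_t} {Q : porderType d}.
Implicit Types (a m r s t y z : Q) (D O : set Q).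

Definition threat t a z m D :=
  [/\ directed D, D `<=` principal_down t, D a, ~ down D z &
    exists2 s, isLub D s & m <= s].

(** The implication is the rule for the pair [(a, z)], the disjunction the rule for [r := a]; one
    enumeration of pairs thus serves both. *)
Definition chain_step O t a z m m' :=
  [/\ O m', m' <= m,
    (exists D, threat t a z m D) ->
      exists c, [/\ c <= t, a <= c, m' <= c & ~ z <= c] &
    m' <= a \/ forall y, O y -> y <= m' -> ~ y <= a].

(** A joint form of meet-continuity for the single set [O]: besides [O t], all that the chain
    construction uses of [O]. *)
Definition approximable O t := forall m D s, O m -> m <= t -> directed D ->
  D `<=` principal_down t -> isLub D s -> m <= s ->
  exists y, [/\ O y, y <= m & down D y].

(** First descend below a member of [D], which has an upper bound in common with [a] in [D]; then go
    below [a] if [O] allows it. The bound [c] survives the second descent. *)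
Lemma chain_step_exists O t a z m : approximable O t -> O m -> m <= t ->
  exists m', chain_step O t a z m m'.
Proof.
move=> approx Om mt.
have [m1 [Om1 m1m m1P]] : exists m1, [/\ O m1, m1 <= m &
    (exists D, threat t a z m D) ->
      exists c, [/\ c <= t, a <= c, m1 <= c & ~ z <= c]].
  have [[D thD]|noD] := pselect (exists D, threat t a z m D); last by exists m.
  case: (thD) => Ddir Dt Da nDz [s Ds ms].
  have [y [Oy ym [i [Di yi]]]] := approx _ _ _ Om mt Ddir Dt Ds ms.
  exists y; split=> // _.
  have [c [Dc ac ic]] := Ddir.2 _ _ Da Di.
  exists c; split=> //; first exact: Dt.
    exact: le_trans yi ic.
  by move=> zc; apply: nDz; exists c.
have [[y [Oy ym1 ya]]|noy] := pselect (exists y, [/\ O y, y <= m1 & y <= a]).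
  exists y; split=> //; first exact: le_trans ym1 m1m.
    by move=> /m1P[c [ct ac m1c zc]]; exists c; split=> //; exact: le_trans m1c.
  by left.
by exists m1; split=> //; right => y Oy ym1 ya; apply: noy; exists y.
Qed.

(** The last clause makes the upper set generated by the chain Scott open relative to the ideal
    below [t]. *)
Lemma exists_scott_chain O t :
  countable [set: Q] -> O t -> approximable O t ->
  (forall A : set Q, A !=set0 -> A `<=` principal_down t ->
     exists s, isLub_in (principal_down t) A s) ->
  exists m : nat -> Q, [/\ m 0%N = t,
    forall i j, (i <= j)%N -> m j <= m i,
    forall i, O (m i) &
    forall D s k, directed D -> D `<=` principal_down t -> isLub D s ->
      m k <= s -> exists j, down D (m j)].
Proof.
move=> Qcount Ot approx sups.
have [|tau tauP] := @countable_recurrent_enum (Q * Q)%type (t, t).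
  by rewrite -setXTT; exact: countableX.
have /choice[f fP] : forall p : nat * Q, exists m', O p.2 -> p.2 <= t ->
    chain_step O t (tau p.1).1 (tau p.1).2 p.2 m'.
  move=> [n m] /=; have [[Om mt]|nOm] := pselect (O m /\ m <= t).
    have [m' ?] := chain_step_exists _ _ (tau n).1 (tau n).2 _ approx Om mt.
    by exists m'.
  by exists t => Om mt; case: nOm.
pose m := fix m n := if n is k.+1 then f (k, m k) else t.
have mP n : O (m n) /\ m n <= t.
  elim: n => [|n [Om mt]]; first by split.
  have [Om' m'm _ _] := fP (n, m n) Om mt.
  by split=> //; exact: le_trans m'm mt.
have mS n : chain_step O t (tau n).1 (tau n).2 (m n) (m n.+1).
  by have [Om mt] := mP n; exact: fP (n, m n) Om mt.
have m_dec i j : (i <= j)%N -> m j <= m i.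
  move=> /subnK <-; elim: (j - i)%N => [//|n IHn].
  by have [_ le_m _ _] := mS (n + i)%N; exact: le_trans le_m IHn.
exists m; split=> [//|//|i|D s k Ddir Dt Ds mks]; first exact: (mP i).1.
apply: contrapT => nDm.
have nD j : ~ down D (m j) by move=> ?; apply: nDm; exists j.
have mls l : (k <= l)%N -> m l <= s by move=> /m_dec/le_trans; apply.
have below a n : D a -> (k <= n)%N -> exists a' y,
    [/\ D a', a <= a', O y, y <= m n & y <= a'].
  move=> Da kn; have [Om mt] := mP n.
  have [y [Oy ym [i [Di yi]]]] := approx _ _ _ Om mt Ddir Dt Ds (mls _ kn).
  have [a' [Da' aa' ia']] := Ddir.2 _ _ Da Di.
  by exists a', y; split=> //; exact: le_trans yi ia'.
(* Triples encode [(n_i, a_i, y_i)]. Along the sequence [u] built below, the [c] of each [next] will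
   bound every [y_j]. *)
pose inv (p : nat * Q * Q) := [/\ (k <= p.1.1)%N, D p.1.2, O p.2,
  p.2 <= m p.1.1 & p.2 <= p.1.2].
pose next (p q : nat * Q * Q) := [/\ (p.1.1 < q.1.1)%N, p.1.2 <= q.1.2 &
  exists c, [/\ c <= t, p.1.2 <= c, m q.1.1 <= c & ~ m p.1.1 <= c]].
have nextP p : inv p -> exists q, inv q /\ next p q.
  case: p => -[n a] y [/= kn Da Oy ym ya].
  (* Wait for a stage treating [(a, m n)]: there [D] is a threat, since its lower closure misses
     [m n]. *)
  have [j nj tauj] := tauP (a, m n) n.
  have [_ _ + _] := mS j; rewrite tauj /= => -[|c [ct ac mjc nmc]].
    exists D; split=> //; exists s => //; apply: mls; exact: leq_trans nj.
  have kj : (k <= j.+1)%N by rewrite leqW // (leq_trans kn).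
  have [a' [y' [Da' aa' Oy' ym' ya']]] := below _ _ Da kj.
  exists (j.+1, a', y'); split; first by split.
  by split=> //=; exists c.
have [a0 Da0] := Ddir.1.
have [a1 [y1 [Da1 _ Oy1 ym1 ya1]]] := below _ _ Da0 (leqnn k).
have /choice[g gP] : forall p, exists q, inv p -> inv q /\ next p q.
  move=> p; have [/nextP[q]|] := pselect (inv p); first by exists q.
  by exists p.
pose u := fix u n := if n is i.+1 then g (u i) else (k, a1, y1).
have uI i : inv (u i).
  by elim: i => [|i /gP[]//]; split.
have uN i : next (u i) (u i.+1) by exact: (gP _ (uI i)).2.
have u_idx i j : (i <= j)%N -> ((u i).1.1 <= (u j).1.1)%N.
  move=> /subnK <-; elim: (j - i)%N => [//|n IHn].
  by have [/ltnW + _ _] := uN (n + i)%N; exact: leq_trans.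
have u_D i j : (i <= j)%N -> (u i).1.2 <= (u j).1.2.
  move=> /subnK <-; elim: (j - i)%N => [//|n IHn].
  by have [_ + _] := uN (n + i)%N; exact: le_trans.
have u_ge i : (i <= (u i).1.1)%N.
  by elim: i => [//|i IHi]; have [lt_u _ _] := uN i; exact: leq_ltn_trans lt_u.
have [|x [i _ <-]|r [rt r_ub r_least]] := sups [set (u i).2 | i in setT].
- by exists (u 0%N).2; exists 0%N.
- have [_ _ _ um _] := uI i; exact: le_trans um (mP _).2.
(* The bound [c] of step [i] is above [y_j] through [a_i] if [j <= i], and through [m] at index
   [n_{i+1}] if [i < j]; hence [r <= c]. *)
have r_small i : ~ m (u i).1.1 <= r.
  move=> mr; have [_ _ [c [ct ac mc nmc]]] := uN i.
  apply: nmc; apply: le_trans mr (r_least c ct _) => _ [j _ <-].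
  have [_ _ _ um ua] := uI j.
  have [ji|ij] := leqP j i.
    exact: le_trans ua (le_trans (u_D _ _ ji) ac).
  exact: le_trans um (le_trans (m_dec _ _ (u_idx _ _ ij)) mc).
(* At a stage treating [r], [r_small] excludes [m j.+1 <= r], and the [y] of [u j.+1] refutes the
   other alternative. *)
have [j _ tauj] := tauP (r, r) 0%N.
have [_ _ _] := mS j; rewrite tauj => -[mr|/(_ (u j.+1).2)].
  by apply: (r_small j.+1); apply: le_trans _ mr; apply: m_dec; exact: u_ge.
have [_ _ Ou um _] := uI j.+1; apply=> //.
  by apply: le_trans um _; apply: m_dec; exact: u_ge.
by apply: r_ub; exists j.+1.
Qed.

End DescendingChain.

(** * Scott openness of the sections of [O] *)

Section ScottClosed.
Context {d : Order.disp_t} {P : porderType d}.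

Lemma scott_closedP (A : set P) : scott_open (~` A) ->
  (forall x y, A y -> x <= y -> A x) /\
  (forall D s, directed D -> D `<=` A -> isLub D s -> A s).
Proof.
move=> [Aup AD]; split=> [x y Ay xy|D s Ddir DA Ds]; apply: contrapT => nA.
  exact: Aup nA xy Ay.
by have [z [/DA Az /(_ Az)]] := AD _ _ Ddir Ds nA.
Qed.

(* Call [c] good if every element of [D] has an
   upper bound in [A] above [c]. By finiteness of [F], above a good [c] and any
   element of [D] there is again a good element, so countability of [D] yields an
   increasing sequence in [A] whose supremum bounds [D]. *)
Lemma up_disjoint_scott_open (A : set P) (y : P) :
  dcpo P -> countable [set: P] ->
  (forall x y : P, exists F : set P,
      finite_set F /\ principal_up x `&` principal_up y = up F) ->
  scott_open (~` A) ->
  scott_open [set x | forall c, x <= c -> y <= c -> ~ A c].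
Proof.
move=> Pdcpo Pcount Pfin Aopen; have [Alow AD] := scott_closedP _ Aopen.
split=> [x x' xP xx' c x'c|D s Ddir Ds sP]; first by apply: xP (le_trans xx' x'c).
apply: contrapT => nD.
pose good c := forall e, D e -> exists c', [/\ A c', c <= c' & e <= c'].
have good_y : good y.
  move=> e De; apply: contrapT => nc; apply: nD; exists e; split=> // c ec yc Ac.
  by apply: nc; exists c.
have goodS c e : good c -> D e -> exists c', [/\ good c', c <= c' & e <= c'].
  move=> gc De; have [F [Ffin FE]] := Pfin c e.
  have [[f Ff gf]|nF] := pselect (exists2 f, F f & good f).
    have [cf ef] : (principal_up c `&` principal_up e) f.
      by rewrite FE; exists f.
    by exists f.
  (* With no good element in [F], each [f] in [F] has an obstruction [h f] in [D]; by finiteness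
     some [b] in [D] bounds them all and [e]. *)
  have /choice[h hP] : forall f, exists b, F f ->
      D b /\ forall c', A c' -> f <= c' -> ~ b <= c'.
    move=> f; have [Ff|nFf] := pselect (F f); last by exists e.
    apply: contrapT => nb; apply: nF; exists f => // b Db.
    apply: contrapT => nc'; apply: nb; exists b => _; split=> // c' Ac' fc' bc'.
    by apply: nc'; exists c'.
  have [b [Db eb hb]] : exists b, [/\ D b, e <= b & forall f, F f -> h f <= b].
    have /finite_seqP[l Fl] := Ffin.
    have : {in l, forall f, D (h f)} by move=> f fl; apply: (hP f _).1; rewrite Fl.
    have -> : F = [set` l] by [].
    elim: (l) => [|f l' IHl] hD; first by exists e; split.
    have [|b [Db eb hb]] := IHl.
      by move=> f' f'l; apply: hD; rewrite inE f'l orbT.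
    have [|b' [Db' bb' hb']] := Ddir.2 b (h f) Db; first by apply: hD; rewrite inE eqxx.
    exists b'; split=> //; first exact: le_trans eb bb'.
    move=> f'; rewrite /= inE => /orP[/eqP ->//|f'l].
    exact: le_trans (hb _ f'l) bb'.
  have [c' [Ac' cc' bc']] := gc _ Db.
  have [f [Ff fc']] : up F c'.
    by rewrite -FE; split=> //; exact: le_trans eb bc'.
  by case: ((hP f Ff).2 _ Ac' fc'); exact: le_trans (hb _ Ff) bc'.
have [tau tauP] := countable_recurrent_enum _ y Pcount.
have /choice[g gP] : forall p : nat * P, exists c', good p.2 ->
    [/\ good c', p.2 <= c' & D (tau p.1) -> tau p.1 <= c'].
  move=> [n c] /=; have [gc|] := pselect (good c); last by exists c.
  have [De|nDe] := pselect (D (tau n)); last by exists c.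
  by have [c' [gc' cc' ec']] := goodS _ _ gc De; exists c'.
pose u := fix u n := if n is i.+1 then g (i, u i) else y.
have uG i : good (u i) by elim: i => [//|i /(gP (i, u i))[]].
have u_inc i j : (i <= j)%N -> u i <= u j.
  move=> /subnK <-; elim: (j - i)%N => [//|n IHn].
  by have [_ le_u _] := gP ((n + i)%N, u (n + i)%N) (uG _); exact: le_trans IHn le_u.
pose E := [set u i | i in setT].
have Edir : directed E.
  split=> [|_ _ [i _ <-] [j _ <-]]; first by exists y, 0%N.
  exists (u (maxn i j)); split; first by exists (maxn i j).
    by apply: u_inc; exact: leq_maxl.
  by apply: u_inc; exact: leq_maxr.
have [c Ec] := Pdcpo _ Edir.
have [e0 De0] := Ddir.1.
have Ac : A c.
  apply: (AD E c Edir _ Ec) => _ [i _ <-].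
  have [c' [Ac' uc' _]] := uG i _ De0; exact: Alow Ac' uc'.
have yc : y <= c by apply: Ec.1; exists 0%N.
apply: (sP c) => //; apply: Ds.2 => e De.
have [n _ taun] := tauP e 0%N.
have [_ _] := gP (n, u n) (uG n); rewrite /= taun => /(_ De) /le_trans; apply.
by apply: Ec.1; exists n.+1.
Qed.

End ScottClosed.

(** * Scott open sets under meet-continuity *)

Section MeetContinuous.
Context {d : Order.disp_t} {P : porderType d}.
Hypothesis P_mc : meet_continuous P.

Lemma meet_continuous_open (U D : set P) (x s : P) : scott_open U -> U x ->
  directed D -> isLub D s -> x <= s -> exists y, [/\ U y, y <= x & down D y].
Proof.
move=> Uo Ux Ddir Ds xs.
have [|y [[yx Dy] Uy]] := P_mc _ _ _ Ddir Ds xs U; last by exists y.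
by apply: open_nbhs_nbhs; split.
Qed.

(** Adding the complement of the ideal to [W] gives a Scott open set; meet-continuity applied to it
    yields points below [w], hence in the ideal and so in [W]. *)
Lemma scott_open_up_down (a : P) (W : set P) : W `<=` principal_down a ->
  (forall x y, W x -> x <= y -> y <= a -> W y) ->
  (forall D s, directed D -> D `<=` principal_down a -> isLub D s -> W s ->
     D `&` W !=set0) ->
  scott_open (up W).
Proof.
move=> Wa Wup WD.
have Uo : scott_open (~` principal_down a `|` W).
  split=> [x y [nxa|Wx] xy|D s Ddir Ds Us].
  - by left => /= ya; apply: nxa; exact: le_trans xy ya.
  - by have [ya|?] := pselect (y <= a); [right; exact: Wup Wx xy ya|left].
  have [Da|nDa] := pselect (D `<=` principal_down a).
    case: Us => [[]|Ws]; first by apply: Ds.2 => z /Da.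
    by have [z [Dz Wz]] := WD _ _ Ddir Da Ds Ws; exists z; split=> //; right.
  apply: contrapT => nDU; apply: nDa => z Dz; apply: contrapT => nza.
  by apply: nDU; exists z; split=> //; left.
split=> [x y [w [Ww wx]] xy|D s Ddir Ds [w [Ww ws]]].
  by exists w; split=> //; exact: le_trans wx xy.
have [|y [Uy yw [e [De ye]]]] := meet_continuous_open _ _ _ _ Uo _ Ddir Ds ws.
  by right.
exists e; split=> //; exists y; split=> //.
by case: Uy => // -[]; exact: le_trans yw (Wa _ Ww).
Qed.

End MeetContinuous.

(** * Componentwise suprema and approximation in the product *)

Section Product.
Context {d : Order.disp_t} {P : porderType d}.

Lemma directed_fst (D : set (P *p P)%type) : directed D -> directed [set p.1 | p in D].
Proof.
move=> [[p Dp] Ddir]; split=> [|_ _ [x Dx <-] [y Dy <-]].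
  by exists p.1, p.
have [z [Dz]] := Ddir _ _ Dx Dy; rewrite !leEprod => /andP[xz _] /andP[yz _].
by exists z.1; split=> //; exists z.
Qed.

Lemma directed_snd (D : set (P *p P)%type) : directed D -> directed [set p.2 | p in D].
Proof.
move=> [[p Dp] Ddir]; split=> [|_ _ [x Dx <-] [y Dy <-]].
  by exists p.2, p.
have [z [Dz]] := Ddir _ _ Dx Dy; rewrite !leEprod => /andP[_ xz] /andP[_ yz].
by exists z.2; split=> //; exists z.
Qed.

Lemma isLub_fst (D : set (P *p P)%type) s : isLub D s -> isLub [set p.1 | p in D] s.1.
Proof.
move=> [sub sleast]; split=> [_ [p /sub + <-]|b bub].
  by rewrite leEprod => /andP[].
suff : s <= ((b, s.2) : (P *p P)%type) by rewrite leEprod => /andP[].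
apply: sleast => p Dp; have := sub _ Dp; rewrite !leEprod => /andP[_ ps] /=.
by rewrite ps andbT; apply: bub; exists p.
Qed.

Lemma isLub_snd (D : set (P *p P)%type) s : isLub D s -> isLub [set p.2 | p in D] s.2.
Proof.
move=> [sub sleast]; split=> [_ [p /sub + <-]|b bub].
  by rewrite leEprod => /andP[].
suff : s <= ((s.1, b) : (P *p P)%type) by rewrite leEprod => /andP[].
apply: sleast => p Dp; have := sub _ Dp; rewrite !leEprod => /andP[ps _] /=.
by rewrite ps /=; apply: bub; exists p.
Qed.

Lemma directed1 (x : P) : directed [set x].
Proof. by split=> [|_ _ -> ->]; exists x. Qed.

Lemma isLub1 (x : P) : isLub [set x] x.
Proof. by split=> [_ ->|y]; [|apply]. Qed.

Lemma directed_setX (D E : set P) : directed D -> directed E ->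
  directed (D `*` E : set (P *p P)%type).
Proof.
move=> [[x0 Dx0] Ddir] [[y0 Ey0] Edir]; split; first by exists (x0, y0).
move=> [x y] [x' y'] [/= Dx Ey] [/= Dx' Ey'].
have [x'' [Dx'' xx'' x'x'']] := Ddir _ _ Dx Dx'.
have [y'' [Ey'' yy'' y'y'']] := Edir _ _ Ey Ey'.
by exists (x'', y''); split; rewrite ?leEprod /= ?xx'' ?yy'' ?x'x'' ?y'y''.
Qed.

Lemma isLub_setX (D E : set P) (r s : P) : D !=set0 -> E !=set0 ->
  isLub D r -> isLub E s -> isLub (D `*` E : set (P *p P)%type) (r, s).
Proof.
move=> [x0 Dx0] [y0 Ey0] [Dr rleast] [Es sleast]; split.
  by move=> [x y] [/= /Dr xr /Es ys]; rewrite leEprod /= xr.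
move=> [b c] bcub; rewrite leEprod; apply/andP; split.
  apply: rleast => x Dx; have := bcub (x, y0) (conj Dx Ey0).
  by rewrite leEprod => /andP[].
apply: sleast => y Ey; have := bcub (x0, y) (conj Dx0 Ey).
by rewrite leEprod => /andP[].
Qed.

Lemma isLub_in_pair (a b : P) :
  (forall (r : P) (A : set P), A !=set0 -> A `<=` principal_down r ->
     exists s, isLub_in (principal_down r) A s) ->
  forall D : set (P *p P)%type, D !=set0 -> D `<=` principal_down ((a, b) : (P *p P)%type) ->
    exists s, isLub_in (principal_down ((a, b) : (P *p P)%type)) D s.
Proof.
move=> sups D [p Dp] Dab.
have [||s1 [s1a s1ub s1least]] := sups a [set p.1 | p in D].
- by exists p.1, p.
- by move=> _ [q /Dab + <-]; rewrite /principal_down /= leEprod => /andP[].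
have [||s2 [s2b s2ub s2least]] := sups b [set p.2 | p in D].
- by exists p.2, p.
- by move=> _ [q /Dab + <-]; rewrite /principal_down /= leEprod => /andP[].
exists (s1, s2); split.
- by rewrite /principal_down /= leEprod; apply/andP; split.
- by move=> q Dq; rewrite leEprod; apply/andP; split;
    [apply: s1ub|apply: s2ub]; exists q.
- move=> [c1 c2]; rewrite /principal_down /= leEprod /= => /andP[ca cb] cub.
  rewrite leEprod; apply/andP; split; [apply: s1least|apply: s2least] => //.
  + by move=> _ [q /cub + <-]; rewrite leEprod => /andP[].
  + by move=> _ [q /cub + <-]; rewrite leEprod => /andP[].
Qed.

(** Lower one coordinate at a time: [m1] within the section at [m2], then [m2] within the section at
    the new [y1]. *)
Lemma meet_continuous_approximable (O : set (P *p P)%type) t :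
  meet_continuous P ->
  (forall y, scott_open [set x | O (x, y)]) ->
  (forall x, scott_open [set y | O (x, y)]) -> approximable O t.
Proof.
move=> P_mc O1 O2 [m1 m2] D s Om _ Ddir _ Ds; rewrite leEprod => /andP[ms1 ms2].
have [y1 [Oy1 ym1 [_ [[p Dp <-] yp]]]] :=
  meet_continuous_open P_mc _ _ _ _ (O1 m2) Om (directed_fst _ Ddir) (isLub_fst _ _ Ds) ms1.
have [y2 [Oy2 ym2 [_ [[q Dq <-] yq]]]] :=
  meet_continuous_open P_mc _ _ _ _ (O2 y1) Oy1 (directed_snd _ Ddir) (isLub_snd _ _ Ds) ms2.
have [r [Dr]] := Ddir.2 _ _ Dp Dq; rewrite !leEprod => /andP[pr _] /andP[_ qr].
exists (y1, y2); split=> //; first by rewrite leEprod ym1.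
by exists r; split=> //; rewrite leEprod (le_trans yp pr) (le_trans yq qr).
Qed.

End Product.

(* For arbitrary dcpos this fails: the Scott topology of the product can be
   strictly finer than the product of the Scott topologies. *)
Lemma scott_open_box {d : Order.disp_t} {P : porderType d}
    (O : set (P *p P)%type) a b :
  countable [set: P] -> meet_continuous P ->
  (forall (r : P) (A : set P), A !=set0 -> A `<=` principal_down r ->
     exists s, isLub_in (principal_down r) A s) ->
  (forall y, scott_open [set x | O (x, y)]) ->
  (forall x, scott_open [set y | O (x, y)]) -> O (a, b) ->
  exists U V : set P, [/\ scott_open U, scott_open V, U a, V b &
    forall x y, U x -> V y -> O (x, y)].
Proof.
move=> P_count P_mc P_sup O1 O2 Oab.
have [||m [m0 mdec Om mP]] := @exists_scott_chain _ (P *p P)%type O (a, b) _ Oab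
  (meet_continuous_approximable O (a, b) P_mc O1 O2).
- by rewrite -setXTT; exact: countableX.
- exact: isLub_in_pair.
have m_le i : (m i).1 <= a /\ (m i).2 <= b.
  by have := mdec _ _ (leq0n i); rewrite m0 leEprod => /andP[].
have mdec1 i j : (i <= j)%N -> (m j).1 <= (m i).1.
  by move=> /mdec; rewrite leEprod => /andP[].
have mdec2 i j : (i <= j)%N -> (m j).2 <= (m i).2.
  by move=> /mdec; rewrite leEprod => /andP[].
pose U := [set x | x <= a /\ exists i, (m i).1 <= x].
pose V := [set y | y <= b /\ exists i, (m i).2 <= y].
exists (up U), (up V); split.
- apply: (scott_open_up_down P_mc a _) => [x []//|x y [_ [i ix]] xy ya|].
    by split=> //; exists i; exact: le_trans ix xy.
  move=> D s Ddir Da Ds [sa [i mis]].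
  (* Pairing [D] with [[set b]] freezes the second coordinate, so the chain property becomes one
     about the first. *)
  have [||||j [[z c] [[/= Dz _]]]] := mP (D `*` [set b]) (s, b) i.
  + exact: directed_setX Ddir (directed1 b).
  + by move=> [x y] [/= /Da xa ->]; rewrite /principal_down /= leEprod /= xa lexx.
  + by apply: isLub_setX => //; [exact: Ddir.1|exists b|exact: isLub1].
  + by rewrite leEprod /= mis (m_le i).2.
  rewrite leEprod => /andP[/= jz _]; exists z; split=> //; split; first exact: Da.
  by exists j.
- apply: (scott_open_up_down P_mc b _) => [y []//|x y [_ [i ix]] xy yb|].
    by split=> //; exists i; exact: le_trans ix xy.
  move=> D s Ddir Db Ds [sb [i mis]].
  have [||||j [[c z] [[/= _ Dz]]]] := mP ([set a] `*` D) (a, s) i.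
  + exact: directed_setX (directed1 a) Ddir.
  + by move=> [x y] [/= -> /Db yb]; rewrite /principal_down /= leEprod /= yb lexx.
  + by apply: isLub_setX => //; [exists a|exact: Ddir.1|exact: isLub1].
  + by rewrite leEprod /= mis (m_le i).1.
  rewrite leEprod => /andP[/= _ jz]; exists z; split=> //; split; first exact: Db.
  by exists j.
- by exists a; split=> //; split=> //; exists 0%N; exact: (m_le _).1.
- by exists b; split=> //; split=> //; exists 0%N; exact: (m_le _).2.
move=> x y [x' [[_ [i ix]] xx']] [y' [[_ [j jy]] yy']].
(* A common index puts one member of the chain below [(x, y)]. *)
have Omax := Om (maxn i j).
apply: ((O1 y).1 (m (maxn i j)).1); last first.
  exact: le_trans (mdec1 _ _ (leq_maxl i j)) (le_trans ix xx').
apply: ((O2 _).1 (m (maxn i j)).2); last first.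
  exact: le_trans (mdec2 _ _ (leq_maxr i j)) (le_trans jy yy').
by case: (m (maxn i j)) Omax.
Qed.

(** * Directedness of irreducible closed sets and sobriety *)

Theorem corollary5p6 (d : Order.disp_t) (P : porderType d)
    (P_nonempty : [set: P] !=set0)
    (P_countable : countable [set: P])
    (P_dcpo : dcpo P)
    (P_meet_continuous : meet_continuous P)
    (P_ideal_sup : forall (r : P) (A : set P),
      A !=set0 -> A `<=` principal_down r ->
      exists s, isLub_in (principal_down r) A s)
    (P_up_finite : forall x y : P, exists F : set P,
      finite_set F /\ principal_up x `&` principal_up y = up F) :
  scott_sober P.
Proof.
move=> A [[a0 Aa0] Aclosed Airr].
have Aopen : scott_open (~` A) := closed_openC Aclosed.
have [Alow AD] := scott_closedP _ Aopen.
have Adir : directed A.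
  split=> [|a b Aa Ab]; first by exists a0.
  apply: contrapT => nub.
  pose O : set (P *p P)%type :=
    [set p | forall c, p.1 <= c -> p.2 <= c -> ~ A c].
  have Oab : O (a, b) by move=> c ac bc Ac; apply: nub; exists c.
  have O1 y : scott_open [set x | O (x, y)] by exact: up_disjoint_scott_open.
  have O2 x : scott_open [set y | O (x, y)].
    rewrite (_ : [set y | _] = [set y | O (y, x)]); first exact: O1.
    by apply/seteqP; split=> y Oxy c /= ? ?; exact: Oxy.
  have [U [V [Uo Vo Ua Vb UVO]]] :=
    scott_open_box O a b P_countable P_meet_continuous P_ideal_sup O1 O2 Oab.
  (* A point [x] of [A] in both [U] and [V] gives [O (x, x)], yet [x] bounds itself in [A]. *)
  have [||x [Ax [Ux Vx]]] := Airr U V Uo Vo; [by exists a|by exists b|].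
  exact: UVO Ux Vx x (lexx x) (lexx x) Ax.
have [s As] := P_dcpo _ Adir.
have sA : A s by exact: AD Adir (fun _ => id) As.
have AE : A = principal_down s.
  by apply/seteqP; split=> x; [exact: As.1|move=> /(Alow _ _ sA)].
exists s; split=> // s' As'; apply/le_anti/andP; split.
  by have : A s by []; rewrite As'.
by apply: As.1; rewrite As'; exact: lexx.
Qed.
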